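(* Let $q>1$ and $n\ge 2$, and let $S$ be an $n$-window sequence over $\mathbb{Z}_q$ with the property that every $n$-tuple $\mathbf{s}_n(i)$ appearing in $S$ has pseudoweight less than $nq/2$. Then $S$ is a negative orientable sequence of order $n$.
   Context: Sequences are periodic with entries in $\mathbb{Z}_q$. For $S=(s_i)$ write $\mathbf{s}_n(i)=(s_i,\ldots,s_{i+n-1})$; for an $n$-tuple $\mathbf{u}=(u_0,\ldots,u_{n-1})$ let $\mathbf{u}^R=(u_{n-1},\ldots,u_0)$ and $-\mathbf{u}=(-u_0,\ldots,-u_{n-1})$. A periodic sequence of period $m$ is an $n$-window sequence if $\mathbf{s}_n(i)=\mathbf{s}_n(j)$ implies $i\equiv j\pmod m$; it is a negative orientable sequence of order $n$ if also $\mathbf{s}_n(i)\neq-\mathbf{s}_n(j)^R$ for all $i,j$. Pseudoweight: define $f:\mathbb{Z}_q\to\mathbb{Q}$ by treating $u$ as an integer in $[0,q-1]$, $f(u)=u$ if $u\neq0$ and $f(0)=q/2$; the pseudoweight of $(u_0,\ldots,u_{n-1})$ is $\sum_i f(u_i)$ computed in $\mathbb{Q}$. *)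

(* Defs.v *)
From mathcomp Require Import all_boot all_order all_algebra.

Import GRing.Theory Num.Theory.
Local Open Scope ring_scope.

(* 'Z_q is the ring of integers mod q only when 1 < q, so every statement
   about these definitions must assume 1 < q. *)

Definition window (q n : nat) (s : nat -> 'Z_q) (i : nat) : n.-tuple 'Z_q :=
  [tuple s (i + k)%N | k < n].

Definition reverse (q n : nat) (u : n.-tuple 'Z_q) : n.-tuple 'Z_q :=
  [tuple of rev u].

Definition negate (q n : nat) (u : n.-tuple 'Z_q) : n.-tuple 'Z_q :=
  [tuple - tnth u k | k < n].

Definition has_period (q m : nat) (s : nat -> 'Z_q) : Prop :=
  (0 < m)%N /\ forall i : nat, s (i + m)%N = s i.

(* The window condition makes a period m the least one: a period m' < m would
   give window 0 = window m' with 0 and m' distinct mod m. *)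
Definition n_window_sequence (q n m : nat) (s : nat -> 'Z_q) : Prop :=
  has_period q m s /\
  forall i j : nat, window q n s i = window q n s j -> i = j %[mod m].

Definition negative_orientable_sequence (q n m : nat) (s : nat -> 'Z_q) :
    Prop :=
  n_window_sequence q n m s /\
  forall i j : nat, window q n s i <> negate q n (reverse q n (window q n s j)).

(* An element u of 'Z_q coerces to its representative in [0, q - 1]. *)
Definition pseudoweight_term (q : nat) (u : 'Z_q) : rat :=
  if u == 0 then q%:R / 2%:R else (nat_of_ord u)%:R.

Definition pseudoweight (q n : nat) (u : n.-tuple 'Z_q) : rat :=
  \sum_(k < n) pseudoweight_term q (tnth u k).

(* Main.v *)
Require Import Defs.
From mathcomp Require Import all_boot all_order all_algebra.
From mathcomp Require Import lra.

Import GRing.Theory.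
Local Open Scope ring_scope.

(** Since [f(-x) = q - f(x)] for every [x], negating a tuple sends its
    pseudoweight [w] to [nq - w], while reversal preserves it; hence no window
    of pseudoweight below [nq/2] is the negated reversal of another. *)

Lemma pseudoweight_termN (q : nat) (x : 'Z_q) : (1 < q)%N ->
  pseudoweight_term q (- x) = q%:R - pseudoweight_term q x.
Proof.
move=> q_gt1; rewrite /pseudoweight_term oppr_eq0.
(* The value [q / 2] at zero is the fixed point of [w -> q - w], as [- 0 = 0] demands. *)
have [_|x_neq0] := eqVneq x 0; first by lra.
have x_gt0 : (0 < x)%N by rewrite lt0n.
have x_le : (x <= q)%N by rewrite -[leqRHS](Zp_cast q_gt1) ltnW.
rewrite -natrB //=; congr (_%:R).
(* The type of [x] mentions the modulus that [Zp_cast] rewrites, so its value is first generalized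
   to a plain natural [k]; [0 < k] then makes the reduction of [q - k] trivial. *)
move: (nat_of_ord x) x_gt0 {x_le} => k k_gt0.
by rewrite Zp_cast // modn_small // ltn_subrL k_gt0 ltnW.
Qed.

Lemma pseudoweight_negate (q n : nat) (u : n.-tuple 'Z_q) : (1 < q)%N ->
  pseudoweight q n (negate q n u) = (n * q)%:R - pseudoweight q n u.
Proof.
move=> q_gt1; rewrite /pseudoweight.
under eq_bigr do rewrite tnth_mktuple pseudoweight_termN //.
by rewrite sumrB sumr_const card_ord natrM mulr_natl.
Qed.

Lemma pseudoweight_reverse (q n : nat) (u : n.-tuple 'Z_q) :
  pseudoweight q n (reverse q n u) = pseudoweight q n u.
Proof.
rewrite /pseudoweight -!(big_tuple _ _ _ xpredT).
by apply/perm_big; rewrite perm_rev.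
Qed.

Theorem theorem2 (q n m : nat) (s : nat -> 'Z_q) (q_gt1 : (1 < q)%N)
    (n_ge2 : (2 <= n)%N) (s_window : n_window_sequence q n m s)
    (s_weight : forall i : nat,
      pseudoweight q n (window q n s i) < (n * q)%:R / 2%:R) :
  negative_orientable_sequence q n m s.
Proof.
split=> // i j eq_ij.
have wi := s_weight i; have wj := s_weight j.
(* With [w] the pseudoweight of window [j], [wi] becomes [nq - w < nq / 2], contradicting [wj]. *)
rewrite eq_ij pseudoweight_negate // pseudoweight_reverse {eq_ij} in wi.
by lra.
Qed.
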